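(* Let $K$ be a field and let $H$ be an $m$-hypergraph with vertex set $V=\{x_1,\dots,x_n\}$ and edge ideal $I\subset K[x_1,\dots,x_n]$. Then $(I^\vee)^2$ has no non-minimal associated primes if and only if for every independent set $S\subset V$, $A_S$ is a sum of two 1-covers of $H$.
   Context: An $m$-hypergraph $H$ consists of a finite vertex set $V=\{x_1,\dots,x_n\}$ and an edge set $E$ whose elements are subsets of $V$ containing $m$ distinct elements. The vertices are identified with the variables of $K[x_1,\dots,x_n]$. The edge ideal $I$ is the ideal generated by the monomials $x_{i_1}\cdots x_{i_m}$ with $\{x_{i_1},\dots,x_{i_m}\}\in E$. Its Alexander dual is $I^\vee=\bigcap_{\{x_{i_1},\dots,x_{i_m}\}\in E}(x_{i_1},\dots,x_{i_m})$. With $\mathbf{N}=\{0,1,2,\dots\}$, a $k$-cover of $H$ is a nonzero element $(a_1,\dots,a_n)\in\mathbf{N}^n$ such that $a_{i_1}+\cdots+a_{i_m}\ge k$ for every edge $\{x_{i_1},\dots,x_{i_m}\}\in E$. Sums of covers are taken componentwise. A set $S\subset V$ (possibly empty) is independent if no edge contains only vertices in $S$. The neighborhood $N(S)$ of an independent set $S$ is the set of vertices $x_i\notin S$ such that there is an edge containing $x_i$ all of whose other $m-1$ vertices lie in $S$. For an independent set $S$, $A_S=(a_1,\dots,a_n)$ is defined by $a_i=0$ if $x_i\in S$, $a_i=2$ if $x_i\in N(S)$, and $a_i=1$ if $x_i\notin S\cup N(S)$. An associated prime of an ideal $J$ of a ring $R$ means an associated prime of $R/J$; it is non-minimal if it is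 not minimal among the primes containing $J$.
   Formalization: The hypergraph is assumed to have at least one edge; with no edges the dual is the whole ring, so there are no associated primes, yet S = V is independent with A_S = 0, which is not a sum of two (nonzero) 1-covers. *)

(* Defs.v *)
From mathcomp Require Import all_boot all_order all_algebra.
From mathcomp Require Import boolp classical_sets.
From mathcomp Require Import mpoly.

Set Implicit Arguments.
Unset Strict Implicit.
Unset Printing Implicit Defensive.

Import GRing.Theory.

Section Hypergraphs.
Local Open Scope set_scope.

Record hypergraph (m n : nat) := Hypergraph {
  edges : {set {set 'I_n}};
  edge_card : forall e, e \in edges -> #|e| = m }.

Variables (m n : nat) (H : hypergraph m n).

(* Vectors of N^n are the exponents 'X_{1..n}, with componentwise sum %MM. *)
Definition kcover (k : nat) (a : 'X_{1..n}) : Prop :=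
  a != 0%MM /\ forall e, e \in edges H -> k <= \sum_(i in e) a i.

Definition independent (S : {set 'I_n}) : bool :=
  [forall e in edges H, ~~ (e \subset S)].

Definition neighborhood (S : {set 'I_n}) : {set 'I_n} :=
  [set i | (i \notin S) &&
           [exists e in edges H, (i \in e) && (e :\ i \subset S)]].

Definition cover_of_set (S : {set 'I_n}) : 'X_{1..n} :=
  [multinom if i \in S then 0 else if i \in neighborhood S then 2 else 1
    | i < n].

End Hypergraphs.

Section Ideals.
Local Open Scope classical_set_scope.
Local Open Scope ring_scope.

Variable R : comNzRingType.
Implicit Types I J P Q X : set R.

(* Unlike [idealr_closed], this allows the unit ideal. *)
Definition is_ideal I : Prop :=
  [/\ I 0, forall u v, I u -> I v -> I (u + v) & forall a u, I u -> I (a * u)].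

Definition ideal_gen X : set R := smallest is_ideal X.

Definition ideal_mul I J : set R := ideal_gen [set u * v | u in I & v in J].

Definition is_prime_ideal P : Prop :=
  idealr_closed (mem P) /\ prime_idealr_closed (mem P).

(* The set [set r | J (r * f)] is the annihilator of the class of f in R / J. *)
Definition associated_prime J P : Prop :=
  is_prime_ideal P /\ exists f : R, P = [set r | J (r * f)].

Definition minimal_prime_over J P : Prop :=
  [/\ is_prime_ideal P, J `<=` P
    & forall Q, is_prime_ideal Q -> J `<=` Q -> Q `<=` P -> Q = P].

End Ideals.

Section AlexanderDual.
Local Open Scope classical_set_scope.
Local Open Scope ring_scope.

(* The Alexander dual of the ideal of K[x_1, .., x_n] generated by the
   monomials \prod_(i in e) 'X_i, for e an edge of H. *)
Definition edge_ideal_dual (K : fieldType) (m n : nat) (H : hypergraph m n) :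
    set {mpoly K[n]} :=
  \bigcap_(e in [set` edges H]) ideal_gen [set 'X_i | i in [set` e]].

End AlexanderDual.

Arguments edge_ideal_dual K {m n} H _.

(* Main.v *)
Require Import Defs.
From mathcomp Require Import all_boot all_order all_algebra.
From mathcomp Require Import boolp classical_sets.
From mathcomp Require Import mpoly.

Set Implicit Arguments.
Unset Strict Implicit.
Unset Printing Implicit Defensive.

Import GRing.Theory.

(** Let [J] be the Alexander dual of the edge ideal. For an edge [e], let [P_e]
    be the prime ideal generated by the variables of [e]. All the ideals in
    sight are spanned by monomials: a monomial lies in the [k]-th power of [P_e]
    when the exponents of the variables of [e] sum to at least [k], so [J] is
    spanned by the 1-covers and its square by the sums of two 1-covers. The
    theorem follows from two equivalences with the condition that every 2-cover
    is a sum of two 1-covers.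

    The first is combinatorial ([cover_of_set_sumP]). Each [A_S] is a 2-cover,
    and every 2-cover [a] is bounded below by [A_S], where [S] is its zero set.
    Since sums of two 1-covers are stable under adding any vector, it suffices
    to decompose the vectors [A_S].

    The second is algebraic. If all 2-covers decompose, the square of [J] is the
    intersection of the squares of the [P_e]. These are primary
    ([weight_ideal_primary], obtained by comparing homogeneous components), so a
    prime that is a colon of the square of [J] is one of the [P_e]
    ([associated_prime_edge]), and these are minimal because no edge contains
    another ([edge_prime_minimal]).

    Conversely, let [a] be a 2-cover that does not decompose
    ([nonminimal_associated_prime]). Raise its entries to a vector [b] which
    still does not decompose but does once any entry below 2 is increased.
    Exponents above 2 play no role, so the colon of the square of [J] by the
    monomial [X^b] is the prime generated by the variables [X_i] with
    [b_i < 2]. It contains some [P_e], and strictly: otherwise [b] would be a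
    2-cover with entries at most 1 on [e] and at least 2 off [e], and such a
    vector decomposes ([sum_of_covers_edge]). This is the required embedded
    prime. *)

(** * Ideals, prime ideals and colons *)

Section Ideals.
Local Open Scope classical_set_scope.
Local Open Scope ring_scope.

Variable R : comNzRingType.
Implicit Types I J P X : set R.

Lemma ideal_gen_ideal X : is_ideal (ideal_gen X).
Proof.
split=> [I [[]]//|u v Xu Xv I hI|a u Xu I hI].
- by have [[_ hD _] _] := hI; apply: hD; [apply: Xu|apply: Xv].
- by have [[_ _ hM] _] := hI; apply: hM; apply: Xu.
Qed.

Lemma ideal_gen_sub X : X `<=` ideal_gen X.
Proof. by move=> x Xx I [_]; apply. Qed.

Lemma ideal_gen_min X I : is_ideal I -> X `<=` I -> ideal_gen X `<=` I.
Proof. by move=> hI hX u; apply. Qed.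

Lemma ideal_sum I (T : Type) (s : seq T) (F : T -> R) :
  is_ideal I -> (forall x, I (F x)) -> I (\sum_(x <- s) F x).
Proof.
case=> I0 ID _ IF; elim: s => [|x s IHs]; first by rewrite big_nil.
by rewrite big_cons; apply: ID.
Qed.

Lemma is_prime_idealP P : is_prime_ideal P <->
  [/\ is_ideal P, ~ P 1 & forall u v, P (u * v) -> P u \/ P v].
Proof.
split=> [[[P0 P1 PL] Pp]|[[P0 PD PM] P1 Pp]].
  split; last 2 first.
  - by move=> h; move/negP: P1; apply; rewrite in_setE.
  - move=> u v h; have := Pp u v; rewrite !in_setE => /(_ h) /orP[] h'.
      by left; move: h'; rewrite in_setE.
    by right; move: h'; rewrite in_setE.
  split; first by move: P0; rewrite in_setE.
  - by move=> u v hu hv; have := PL 1 u v; rewrite !in_setE mul1r; apply.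
  - move=> a u hu; have := PL a u 0; rewrite !in_setE addr0; apply=> //.
    by move: P0; rewrite in_setE.
split; last first.
  move=> u v; rewrite in_setE => /Pp[h|h]; apply/orP.
    by left; rewrite in_setE.
  by right; rewrite in_setE.
split; first by rewrite in_setE.
- by apply/negP; rewrite in_setE.
- by move=> a u v; rewrite !in_setE => hu hv; apply: PD => //; apply: PM.
Qed.

Lemma prime_ideal_prod P (T : eqType) (s : seq T) (Q : pred T) (F : T -> R) :
  is_prime_ideal P -> P (\prod_(x <- s | Q x) F x) -> exists2 x, Q x & P (F x).
Proof.
move=> /is_prime_idealP[_ P1 Pp]; elim: s => [|x s IHs]; first by rewrite big_nil.
rewrite big_cons; case: ifP => // Qx /Pp[h|]; [by exists x | exact: IHs].
Qed.

End Ideals.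

(** * Monomial ideals *)

Section MonomialIdeals.
Local Open Scope ring_scope.

Variables (K : fieldType) (n : nat).
Implicit Types (A B : 'X_{1..n} -> Prop) (a b c d : 'X_{1..n}) (e T : {set 'I_n}).
Implicit Types (f g r : {mpoly K[n]}).

(** Stability under increasing entries, that is, under multiplying monomials. *)
Definition upward_closed A : Prop := forall a b, A a -> (a <= b)%MM -> A b.

(** The polynomials all of whose monomials have their exponent in [A]; this is
    an ideal when [A] is upward closed. *)
Definition monomial_ideal A : set {mpoly K[n]} :=
  [set f | forall a, a \in msupp f -> A a]%classic.

Lemma lem_addl a b : (a <= b + a)%MM.
Proof. by apply/mnm_lepP=> i; rewrite mnmDE leq_addl. Qed.

Lemma monomial_ideal_ideal A : upward_closed A -> is_ideal (monomial_ideal A).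
Proof.
move=> upA; split=> [a|u v hu hv a|r u hu a]; first by rewrite msupp0.
- by move/msuppD_le; rewrite mem_cat => /orP[/hu|/hv].
- move/msuppM_le => /allpairsP[[b c] /= [_ hc ->]].
  by apply: upA (hu c hc) _; exact: lem_addl.
Qed.

Lemma monomial_idealX A a : monomial_ideal A 'X_[a] <-> A a.
Proof.
split=> [|Aa b]; first by apply; rewrite msuppX mem_seq1.
by rewrite msuppX mem_seq1 => /eqP->.
Qed.

Lemma monomial_ideal_min A (I : set {mpoly K[n]}) : is_ideal I ->
  (forall a, A a -> I 'X_[a]) -> (monomial_ideal A `<=` I)%classic.
Proof.
move=> hI hA f hf; rewrite [f]mpolyE big_seq big_mkcond.
apply: ideal_sum => // a; have [_ _ IM] := hI; case: ifP => [ha|_]; last by case: hI.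
by rewrite -mul_mpolyC; apply: IM; apply: hA; apply: hf.
Qed.

(** The total exponent of the variables of [e] in the monomial [a]. *)
Definition weight e a : nat := (\sum_(i in e) a i)%N.

Lemma weightD e a b : weight e (a + b)%MM = (weight e a + weight e b)%N.
Proof. by rewrite /weight -big_split; apply: eq_bigr => i _; rewrite mnmDE. Qed.

Lemma weight_gt0P e a :
  reflect (exists2 i, i \in e & (0 < a i)%N) (0 < weight e a)%N.
Proof.
rewrite lt0n /weight sum_nat_eq0 negb_forall.
apply: (iffP existsP) => [[i]|[i ie ai]].
  by rewrite negb_imply => /andP[ie]; rewrite -lt0n; exists i.
by exists i; rewrite negb_imply ie -lt0n.
Qed.

Lemma leq_weight e a b : (a <= b)%MM -> (weight e a <= weight e b)%N.
Proof. by move/mnm_lepP=> ab; apply: leq_sum. Qed.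

(** The [k]-th power of the prime ideal generated by the variables of [e]. *)
Definition weight_ideal e k : set {mpoly K[n]} :=
  monomial_ideal (fun a => k <= weight e a)%N.

Lemma weight_ideal_ideal e k : is_ideal (weight_ideal e k).
Proof.
by apply: monomial_ideal_ideal => a b /= h ab; apply: leq_trans h (leq_weight _ ab).
Qed.

Lemma weight_ideal_vars e : ideal_gen [set 'X_i | i in [set` e]]%classic = weight_ideal e 1.
Proof.
apply/seteqP; split.
  apply: ideal_gen_min; first exact: weight_ideal_ideal.
  move=> _ [i /= ie <-]; apply/monomial_idealX; apply/weight_gt0P.
  by exists i; rewrite // mnm1E eqxx.
have [_ _ hM] := ideal_gen_ideal [set ('X_i : {mpoly K[n]}) | i in [set` e]]%classic.
apply: monomial_ideal_min; first exact: ideal_gen_ideal.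
move=> a /weight_gt0P[i ie ai].
have -> : a = ((a - U_(i)) + U_(i))%MM.
  by rewrite submK //; apply/mnm_lepP=> j; rewrite mnm1E; case: eqP => // <-.
by rewrite mpolyXD; apply: hM; apply: ideal_gen_sub; exists i.
Qed.

(** The morphism multiplying each variable of [e] by a new indeterminate: its
    coefficients are the components of a polynomial that are homogeneous for
    the weight [e]. *)
Definition grading e : {mpoly K[n]} -> {poly {mpoly K[n]}} :=
  mmap (polyC \o @mpolyC n K)
       (fun i => ('X_i)%:P * (if i \in e then 'X else 1)).

Lemma gradingM e f g : grading e (f * g) = grading e f * grading e g.
Proof. exact: (mmap_is_multiplicative _ _).1. Qed.

Lemma coef_grading e f k a :
  ((grading e f)`_k)@_a = if weight e a == k then f@_a else 0.
Proof.
have mon b : mmap1 (fun i => ('X_i)%:P * (if i \in e then 'X else 1)) b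
    = ('X_[b] : {mpoly K[n]})%:P * 'X^(weight e b) :> {poly {mpoly K[n]}}.
  rewrite /mmap1 /weight mpolyXE_id rmorph_prod -prodrXr [X in _ * X]big_mkcond /=.
  rewrite -big_split /=; apply: eq_bigr => i _.
  by rewrite exprMn_comm ?rmorphXn; [case: ifP; rewrite ?expr1n | exact: mulrC].
have term b : ((((polyC \o @mpolyC n K) f@_b)
      * mmap1 (fun i => ('X_i)%:P * (if i \in e then 'X else 1)) b)`_k)@_a
    = if weight e a == k then (f@_b *: 'X_[b])@_a else 0.
  rewrite mon /= mulrA -polyCM coefCM mul_mpolyC coefXn mcoeffZ mulr_natr.
  rewrite mcoeffMn mcoeffZ mcoeffX.
  have [->|] := eqVneq b a; last by rewrite !mulr0 mul0rn if_same.
  by rewrite !mulr1 eq_sym; case: eqP.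
rewrite /grading /mmap coef_sum raddf_sum /= (eq_bigr _ (fun b _ => term b)).
case: eqP => _; last by rewrite big1.
by rewrite [in RHS](mpolyE f) raddf_sum.
Qed.

Lemma weight_ideal_coefP e k f :
  weight_ideal e k f <-> forall j, (j < k)%N -> (grading e f)`_j = 0.
Proof.
split=> [hf j jk|h a].
  apply/mpolyP=> a; rewrite coef_grading mcoeff0; case: eqP => // aj.
  apply/eqP; rewrite mcoeff_eq0; apply/negP => /hf /=.
  by rewrite aj leqNgt jk.
rewrite mcoeff_msupp => fa; rewrite leqNgt; apply/negP => /h /mpolyP/(_ a).
by rewrite coef_grading eqxx mcoeff0; apply/eqP.
Qed.

(** The powers of a prime ideal generated by variables are primary: if
    the component [r_0] of weight zero of [r] is nonzero and the components of
    [f] of weight less than [j] vanish, then the component of weight [j] of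
    [r * f] is the product of [r_0] and [f_j]. *)
Lemma weight_ideal_primary e k r f :
  weight_ideal e k (r * f) -> ~ weight_ideal e 1 r -> weight_ideal e k f.
Proof.
move=> /weight_ideal_coefP hrf hr; apply/weight_ideal_coefP.
have r0 : (grading e r)`_0 != 0.
  by apply/eqP => r0; apply: hr; apply/weight_ideal_coefP => -[|//] _.
elim/ltn_ind=> j IHj jk; have := hrf j jk.
rewrite gradingM coefM big_ord_recl big1 /= => [|i _].
  by rewrite subn0 addr0 => /eqP; rewrite mulf_eq0 (negPf r0) => /eqP.
rewrite [X in _ * X]IHj ?mulr0 // /bump /=.
  by rewrite ltn_subrL /= (leq_ltn_trans _ (ltn_ord i)).
by apply: leq_ltn_trans (leq_subr _ _) jk.
Qed.

Lemma weight_ideal_mul e k r f :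
  weight_ideal e 1 r -> weight_ideal e k f -> weight_ideal e k.+1 (r * f).
Proof.
move=> hr hf a /msuppM_le /allpairsP[[b c] /= [/hr hb /hf hc ->]].
by rewrite weightD -add1n leq_add.
Qed.

Lemma weight_ideal_prime e : is_prime_ideal (weight_ideal e 1).
Proof.
apply/is_prime_idealP; split; first exact: weight_ideal_ideal.
  move/(_ 0%MM); rewrite msupp1 mem_seq1 eqxx => /(_ isT) /weight_gt0P[i _].
  by rewrite mnm0E.
move=> u v huv; case: (pselect (weight_ideal e 1 u)) => hu; first by left.
by right; apply: weight_ideal_primary huv hu.
Qed.

End MonomialIdeals.

Arguments monomial_ideal K {n} A _.
Arguments weight_ideal K {n} e k _.

(** * Covers of a hypergraph *)

Section Covers.
Variables (m n : nat) (H : hypergraph m n).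
Implicit Types (a b c d : 'X_{1..n}) (e T S : {set 'I_n}).

(** A [k]-cover that is allowed to be zero. *)
Definition weak_cover k a : Prop :=
  forall e, e \in edges H -> k <= weight e a.

(** The exponents of the monomials of the square of the dual ideal. *)
Definition sum_of_covers a : Prop :=
  exists b c, [/\ weak_cover 1 b, weak_cover 1 c & a = (b + c)%MM].

Lemma weak_cover_upward k : upward_closed (weak_cover k).
Proof. by move=> a b ha ab e /ha h; apply: leq_trans h (leq_weight _ ab). Qed.

Lemma sum_of_covers_upward : upward_closed sum_of_covers.
Proof.
move=> _ a [b [c [hb hc ->]]] bca; exists (a - (b + c) + b)%MM, c.
split=> //; last by rewrite -addmA submK.
by apply: weak_cover_upward hb _; exact: lem_addl.
Qed.

Lemma sum_of_covers_double b : weak_cover 1 b -> sum_of_covers (b + b)%MM.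
Proof. by move=> hb; exists b, b. Qed.

Lemma sum_of_covers_weak_cover2 a : sum_of_covers a -> weak_cover 2 a.
Proof.
by move=> [b [c [hb hc ->]]] e eH; rewrite weightD -[2]addn1 leq_add ?hb ?hc.
Qed.

Lemma kcover1P a : edges H != finset.set0 -> (kcover H 1 a <-> weak_cover 1 a).
Proof.
move=> /set0Pn[e eH]; split=> [[_ h] //|ha]; split=> //.
apply/eqP=> a0; have /weight_gt0P[i _] := ha e eH.
by rewrite a0 mnm0E.
Qed.

(** Every 1-cover contains a squarefree one, so that exponents above 2 are
    irrelevant for being a sum of two 1-covers. *)
Lemma sum_of_covers_truncate a :
  sum_of_covers a -> sum_of_covers [multinom minn (a i) 2 | i < n].
Proof.
move=> [b [c [hb hc ->]]].
have sqfree d : weak_cover 1 d -> weak_cover 1 [multinom minn (d i) 1 | i < n].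
  move=> hd e /hd /weight_gt0P[i ie di]; apply/weight_gt0P; exists i => //.
  by rewrite mnmE leq_min di.
apply: (@sum_of_covers_upward
  ([multinom minn (b i) 1 | i < n] + [multinom minn (c i) 1 | i < n])%MM).
  by exists [multinom minn (b i) 1 | i < n], [multinom minn (c i) 1 | i < n];
    split=> //; exact: sqfree.
apply/mnm_lepP=> i; rewrite !(mnmDE, mnmE) leq_min.
by rewrite leq_add ?geq_minl //= -[2]addn1 leq_add ?geq_minr.
Qed.

(** The 0/1 vector with support [T]. *)
Definition indicator T : 'X_{1..n} := [multinom (i \in T : nat) | i < n].

Lemma indicatorE T i : indicator T i = (i \in T) :> nat.
Proof. exact: mnmE. Qed.

Lemma indicator_cover T :
  (forall e, e \in edges H -> ~~ (e \subset ~: T)) -> weak_cover 1 (indicator T).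
Proof.
move=> hT e /hT /subsetPn[i ie]; rewrite inE negbK => iT.
by apply/weight_gt0P; exists i => //; rewrite indicatorE iT.
Qed.

Lemma subset_edges e e' : e \in edges H -> e' \in edges H -> e \subset e' -> e = e'.
Proof.
by move=> eH e'H ee'; apply/eqP; rewrite eqEcard ee' (edge_card eH) (edge_card e'H) leqnn.
Qed.

Lemma cover_of_set_weak_cover2 S : independent H S -> weak_cover 2 (cover_of_set H S).
Proof.
move=> /forall_inP indS e eH; have /subsetPn[i ie iS] := indS e eH.
rewrite /weight (bigD1 i) //= mnmE (negPf iS).
case: ifP => [_|/negbT iN]; first exact: leq_addr.
rewrite -[2]addn1 leq_add2l; have : ~~ (e :\ i \subset S).
  apply: contra iN => eiS; rewrite inE iS /=.
  by apply/existsP; exists e; rewrite eH ie.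
move=> /subsetPn[j]; rewrite !inE => /andP[ji je] jS.
rewrite (bigD1 j) /=; last by rewrite je.
by rewrite mnmE (negPf jS); case: ifP.
Qed.

(** The set [S] is the zero set of [a]: the entry of [a] at a neighbor of [S] is
    its whole weight on some edge. *)
Lemma weak_cover2_above_cover_of_set a : weak_cover 2 a ->
  exists2 S, independent H S & (cover_of_set H S <= a)%MM.
Proof.
move=> ha; exists [set i | a i == 0]%SET.
  apply/forall_inP=> e eH; apply/negP=> /fintype.subsetP eS.
  have := ha e eH; rewrite /weight big1 // => i /eS.
  by rewrite inE => /eqP.
apply/mnm_lepP=> i; rewrite mnmE !inE; case: eqP => //= /eqP ai.
case: existsP => [[e /andP[eH /andP[ie /fintype.subsetP eiS]]]|_]; last by rewrite lt0n.
have := ha e eH; rewrite /weight (bigD1 i) //= big1 ?addn0 // => j /andP[je ji].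
by have := eiS j; rewrite !inE ji je => /(_ isT) /eqP.
Qed.

Lemma cover_of_set_sumP : (forall S, independent H S -> sum_of_covers (cover_of_set H S))
  <-> (forall a, weak_cover 2 a -> sum_of_covers a).
Proof.
split=> [h a /weak_cover2_above_cover_of_set[S /h hS]|h S /cover_of_set_weak_cover2 /h //].
exact: sum_of_covers_upward.
Qed.

(** A vector outside an upward closed family can be raised until any further
    increase of an entry below 2 leads into the family. *)
Lemma saturate (A : 'X_{1..n} -> Prop) a : ~ A a ->
  exists b, [/\ ~ A b, (a <= b)%MM & forall i, b i < 2 -> A (b + U_(i))%MM].
Proof.
have [N] := ubnP (\sum_(i < n) (2 - a i)); elim: N a => // N IHN a aN nAa.
case: (pselect (exists2 i, a i < 2 & ~ A (a + U_(i))%MM)) => [[i ai nAai]|h].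
  have [] := IHN _ _ nAai.
    rewrite ltnS in aN; apply: leq_trans aN; rewrite [X in _ < X](bigD1 i) //= (bigD1 i) //=.
    rewrite mnmDE mnm1E eqxx addn1 -addSn leq_add //.
      by rewrite ltn_sub2l.
    by apply: leq_sum => j _; rewrite leq_sub2l // mnmDE leq_addr.
  move=> b [nAb ab sat]; exists b; split=> //.
  by apply: lepm_trans ab; rewrite addmC lem_addl.
exists a; split=> // [|i ai]; first exact: lepm_refl.
by apply: contrapT => nAai; apply: h; exists i.
Qed.

(** Two entries of [b] on [e] equal 1. Each of them, together with the vertices
    off [e], supports a 1-cover, because every other edge leaves [e]. *)
Lemma sum_of_covers_edge b e : e \in edges H ->
  weak_cover 2 b -> (forall i, i \notin e -> 2 <= b i) ->
  (forall i, i \in e -> b i < 2) -> sum_of_covers b.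
Proof.
move=> eH hb off on.
have /weight_gt0P[i ie bi] : 0 < weight e b by apply: leq_trans (hb e eH).
have [j je /andP[ji bj]] : exists2 j, j \in e & (j != i) && (0 < b j).
  have := hb e eH; rewrite /weight (bigD1 i) //= => h.
  have : 0 < \sum_(j in e | j != i) b j.
    by move: h (on i ie); case: (b i) => [|[|]] //; rewrite add0n => /ltnW.
  rewrite lt0n sum_nat_eq0 negb_forall => /existsP[j].
  by rewrite negb_imply -lt0n => /andP[/andP[je ji] bj]; exists j; rewrite ?ji.
have cov k : k \in e -> weak_cover 1 (indicator (k |: ~: e)).
  move=> ke; apply: indicator_cover => e' e'H; rewrite finset.setCU finset.setCK.
  apply/negP=> /[dup] /fintype.subset_trans/(_ (finset.subsetIr _ _)) e'e.
  rewrite (subset_edges e'H eH e'e) => /fintype.subsetP/(_ k ke).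
  by rewrite !inE eqxx.
apply: (@sum_of_covers_upward (indicator (i |: ~: e) + indicator (j |: ~: e))%MM).
  by exists (indicator (i |: ~: e)), (indicator (j |: ~: e)); split=> //; exact: cov.
apply/mnm_lepP=> k; rewrite mnmDE !indicatorE !inE.
case: (boolP (k \in e)) => [ke|/off bk]; last by rewrite !orbT.
rewrite !orbF; have [->|_] := eqVneq k i; first by rewrite eq_sym (negPf ji).
by rewrite add0n; case: eqP => [->|].
Qed.

End Covers.

(** * The square of the Alexander dual *)

Section DualSquare.
Local Open Scope classical_set_scope.
Local Open Scope ring_scope.

Variables (K : fieldType) (m n : nat) (H : hypergraph m n).
Let J := edge_ideal_dual K H.

Lemma edge_ideal_dual_monomial : J = monomial_ideal K (weak_cover H 1).
Proof.
apply/seteqP; split=> f Jf.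
  by move=> a af e eH; have := Jf e eH; rewrite weight_ideal_vars; apply.
by move=> e /= eH; rewrite weight_ideal_vars => a /Jf; apply.
Qed.

Lemma dual_square_monomial : ideal_mul J J = monomial_ideal K (sum_of_covers H).
Proof.
rewrite edge_ideal_dual_monomial; apply/seteqP; split.
  apply: ideal_gen_min.
    exact: monomial_ideal_ideal (@sum_of_covers_upward _ _ H).
  move=> _ [u hu [v hv <-]] _ /msuppM_le /allpairsP[[b c] /= [/hu hb /hv hc ->]].
  by exists b, c.
apply: monomial_ideal_min; first exact: ideal_gen_ideal.
move=> _ [b [c [hb hc ->]]]; rewrite mpolyXD; apply: ideal_gen_sub.
by exists 'X_[b]; [|exists 'X_[c]]; rewrite ?monomial_idealX //; apply/monomial_idealX.
Qed.

Lemma dual_square_sub_edge e : e \in edges H -> ideal_mul J J `<=` weight_ideal K e 1.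
Proof.
move=> eH; rewrite dual_square_monomial => f hf a /hf /sum_of_covers_weak_cover2.
by move/(_ e eH) => /ltnW.
Qed.

Lemma edge_prime_minimal e : e \in edges H ->
  minimal_prime_over (ideal_mul J J) (weight_ideal K e 1).
Proof.
move=> eH; split=> [||Q Qpr JQ Qe]; first exact: weight_ideal_prime.
  exact: dual_square_sub_edge.
have /is_prime_idealP[Qid _ Qp] := Qpr; apply/seteqP; split=> //.
rewrite -weight_ideal_vars; apply: ideal_gen_min => // _ [i /= ie <-].
(* The variable [X_i] times all the variables outside [e] is a 1-cover, so its
   square lies in [Q], while the variables outside [e] do not lie in [Q]. *)
pose b := indicator (~: e)%SET.
have hb : weak_cover H 1 (U_(i) + b)%MM.
  move=> e' e'H; case: (boolP (e' \subset e)) => [e'e|/fintype.subsetPn[j je' je]].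
    rewrite (subset_edges e'H eH e'e); apply/weight_gt0P; exists i => //.
    by rewrite mnmDE mnm1E eqxx.
  apply/weight_gt0P; exists j => //.
  by rewrite mnmDE indicatorE finset.in_setC je addn1.
have : Q ('X_[U_(i) + b] * 'X_[U_(i) + b]).
  rewrite -mpolyXD; apply: JQ; rewrite dual_square_monomial.
  by apply/monomial_idealX; apply: sum_of_covers_double.
have Qi : Q 'X_[U_(i) + b] -> Q 'X_i.
  rewrite mpolyXD => /Qp[//|/Qe /monomial_idealX /weight_gt0P[j je]].
  by rewrite indicatorE finset.in_setC je.
by case/Qp.
Qed.

(** If the square of the dual contains all 2-covers, it is an intersection of
    primary ideals belonging to the primes of the edges; a prime colon is then
    one of these primes. *)
Lemma associated_prime_edge P : (forall a, weak_cover H 2 a -> sum_of_covers H a) ->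
  associated_prime (ideal_mul J J) P ->
  exists2 e, e \in edges H & P = weight_ideal K e 1.
Proof.
move=> cov2 [Ppr [f Pf]].
have inJJ g : (forall e, e \in edges H -> weight_ideal K e 2 g) -> ideal_mul J J g.
  rewrite dual_square_monomial => hg a ag; apply: cov2 => e eH; exact: hg eH a ag.
have Psub e : e \in edges H -> ~ weight_ideal K e 2 f -> P `<=` weight_ideal K e 1.
  move=> eH nef r; rewrite Pf /= dual_square_monomial => hrf.
  apply: contrapT => nr; apply: nef; apply: weight_ideal_primary nr => a /hrf.
  by move/sum_of_covers_weak_cover2; apply.
have /is_prime_idealP[Pid _ Pp] := Ppr; have [_ _ PM] := Pid.
pose T := [set i | `[< ~ P 'X_i >]]%SET.
pose t : {mpoly K[n]} := 'X_[indicator T].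
have nPt : ~ P t.
  rewrite /t mpolyXE_id => /(prime_ideal_prod Ppr)[i _]; rewrite indicatorE inE.
  case: asboolP => [nPi /= /nPi //|_]; rewrite expr0.
  by have /is_prime_idealP[_] := Ppr.
(* The monomial [t] is the product of the variables outside [P]: it is not in
   [P], and neither is its square. *)
have [e eH [nef et]] : exists2 e, e \in edges H &
    ~ weight_ideal K e 2 f /\ ~ weight_ideal K e 1 t.
  apply: contrapT => h; have : P (t * t).
    rewrite Pf /=; apply: inJJ => e eH.
    have [_ _ WM] := weight_ideal_ideal K e 2.
    case: (pselect (weight_ideal K e 2 f)) => [/WM //|nef]; rewrite mulrC; apply: (WM f).
    case: (pselect (weight_ideal K e 1 t)) => et; first exact: weight_ideal_mul.
    by case: h; exists e.
  by case/Pp.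
exists e => //; apply/seteqP; split; first exact: Psub.
rewrite -weight_ideal_vars; apply: ideal_gen_min => // _ [i /= ie <-].
apply: contrapT => nPi; apply: et; apply/monomial_idealX/weight_gt0P.
by exists i => //; rewrite indicatorE inE; case: asboolP.
Qed.

(** A 2-cover which is not a sum of two 1-covers yields an embedded prime. *)
Lemma nonminimal_associated_prime a : weak_cover H 2 a -> ~ sum_of_covers H a ->
  exists P, associated_prime (ideal_mul J J) P /\ ~ minimal_prime_over (ideal_mul J J) P.
Proof.
move=> ha na; have [b [nb ab sat]] := saturate na.
have hb : weak_cover H 2 b := weak_cover_upward ha ab.
pose T := [set i | (b i < 2)%N]%SET; exists (weight_ideal K T 1).
(* The colon by [X^b] is the prime generated by the variables of [T]. *)
have colon : weight_ideal K T 1 = [set r | ideal_mul J J (r * 'X_[b])].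
  rewrite dual_square_monomial; apply/seteqP; split=> r /= hr c.
    rewrite (perm_mem (msuppMX _ _)) => /mapP[d /hr /weight_gt0P[i] + di ->].
    rewrite inE => /sat hi; apply: sum_of_covers_upward hi _.
    apply/mnm_lepP=> j; rewrite !mnmDE mnm1E leq_add2l.
    by case: eqP => // <-.
  move=> cr; apply: contrapT => nTc; apply: nb.
  have /sum_of_covers_truncate hbc : sum_of_covers H (b + c)%MM.
    by apply: hr; rewrite (perm_mem (msuppMX _ _)); apply: map_f.
  apply: sum_of_covers_upward hbc _; apply/mnm_lepP=> i; rewrite mnmE mnmDE.
  case: (ltnP (b i) 2) => [bi|bi]; last exact: leq_trans (geq_minr _ _) bi.
  suff -> : c i = 0%N by rewrite addn0 geq_minl.
  apply/eqP; rewrite -leqn0 leqNgt; apply/negP => ci; apply: nTc.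
  by apply/weight_gt0P; exists i; rewrite ?inE.
split; first by split; [exact: weight_ideal_prime | exists 'X_[b]].
(* [T] contains an edge since the variables outside [T] do not form a 1-cover. *)
have [e eH eT] : exists2 e, e \in edges H & e \subset T.
  apply: contrapT => nT.
  have hT : weak_cover H 1 (indicator (~: T)%SET).
    apply: indicator_cover => e eH; rewrite finset.setCK; apply/negP => eT.
    by apply: nT; exists e.
  have : weight_ideal K T 1 'X_[indicator (~: T)%SET + indicator (~: T)%SET].
    rewrite colon /= dual_square_monomial -mpolyXD; apply/monomial_idealX.
    by apply: sum_of_covers_upward (sum_of_covers_double hT) _; rewrite addmC lem_addl.
  case/monomial_idealX/weight_gt0P=> i iT.
  by rewrite mnmDE indicatorE finset.in_setC iT.
case=> _ _ /(_ _ (weight_ideal_prime K e) (dual_square_sub_edge eH)) Tmin.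
have eqT : weight_ideal K e 1 = weight_ideal K T 1.
  apply: Tmin => g hg c /hg /weight_gt0P[i ie ci]; apply/weight_gt0P; exists i => //.
  exact: (fintype.subsetP eT).
apply: nb; apply: (sum_of_covers_edge eH hb) => i ie.
  rewrite leqNgt; apply/negP => bi.
  have : weight_ideal K e 1 'X_i.
    rewrite eqT; apply/monomial_idealX/weight_gt0P.
    by exists i; rewrite ?inE // mnm1E eqxx.
  case/monomial_idealX/weight_gt0P=> j je; rewrite mnm1E.
  by case: eqP => // ij; rewrite ij je in ie.
by have := fintype.subsetP eT i ie; rewrite inE.
Qed.

End DualSquare.

Theorem theorem1p3 (K : fieldType) (m n : nat) (H : hypergraph m n)
    (H_has_edge : edges H != finset.set0) :
  let J := edge_ideal_dual K H in
  (~ exists P : set {mpoly K[n]},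
       associated_prime (ideal_mul J J) P /\
       ~ minimal_prime_over (ideal_mul J J) P)
  <->
  (forall S : {set 'I_n}, independent H S ->
     exists b c : 'X_{1..n},
       [/\ kcover H 1 b, kcover H 1 c & cover_of_set H S = (b + c)%MM]).
Proof.
have covP S : sum_of_covers H (cover_of_set H S) <-> exists b c : 'X_{1..n},
    [/\ kcover H 1 b, kcover H 1 c & cover_of_set H S = (b + c)%MM].
  by split=> -[b [c [hb hc ->]]]; exists b, c; split=> //; apply/(kcover1P _ H_has_edge).
split=> [noemb S indS|allS [P [Pass Pmin]]].
  apply/covP; move: S indS; apply/cover_of_set_sumP => a ha.
  apply: contrapT => na; apply: noemb.
  exact: nonminimal_associated_prime ha na.
have cov2 : forall a, weak_cover H 2 a -> sum_of_covers H a.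
  by apply/cover_of_set_sumP => S /allS /covP.
have [e eH Pe] := associated_prime_edge cov2 Pass.
by apply: Pmin; rewrite Pe; exact: edge_prime_minimal.
Qed.
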